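(* For all positive integers $d$ and integers $n\geq0$, \[ C_n^{(d)}=P_n^{(d)}+P_{n-d}^{(d)}+P_{n-2d}^{(d)}+P_{n-3d}^{(d)}+\cdots . \]
   Context: $P_m^{(d)}$ denotes the number of partitions of the integer $m$ into at most $d$ parts (so $P_0^{(d)}=1$), and $P_m^{(d)}=0$ for $m<0$. $\Lambda_d=\mathbb{Z}_{\geq0}^d$ with basis $\mathbf{e}(1),\dots,\mathbf{e}(d)$; $X_d=\{\mathbf{e}(k)-\mathbf{e}(i)-\mathbf{e}(j): i,j,k\in\{1,\dots,d\},\ d\mid k-i-j\}$; for $\mathbf{v},\mathbf{w}\in\Lambda_d$, $\mathbf{v}\lessdot\mathbf{w}$ iff $\mathbf{v}-\mathbf{w}\in X_d$; $\prec$ is the transitive closure of $\lessdot$ on $\Lambda_d$ (chains staying in $\Lambda_d$). $C_n^{(d)}=|\{n\mathbf{e}(1)\}\cup\{\mathbf{w}\in\Lambda_d:\mathbf{w}\prec n\mathbf{e}(1)\}|$. *)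

(* Defs.v *)
From Stdlib Require Import Relation_Operators.
From mathcomp Require Import all_boot all_order all_algebra.
From mathcomp Require Import boolp classical_sets functions cardinality fsbigop.

Set Implicit Arguments.
Unset Strict Implicit.
Unset Printing Implicit Defensive.

Import GRing.Theory.
Local Open Scope ring_scope.
Local Open Scope classical_set_scope.

Definition is_partition (m : nat) (s : seq nat) : bool :=
  [&& sorted geq s, all (leq 1) s & sumn s == m].

(* [d.-bseq T] is the finite type of sequences over [T] of length at most [d].
   Taking parts in ['I_m.+1] loses nothing: parts of a partition of [m] are at
   most [m]. *)
Definition npart_nat (d m : nat) : nat :=
  #|[set s : d.-bseq 'I_m.+1 | is_partition m (map val s)]%SET|.

Definition npart (d : nat) (m : int) : nat :=
  match m with
  | Posz m => npart_nat d m
  | Negz _ => 0%N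
  end.

Notation Lambda d := 'rV[nat]_d.

(* The basis is indexed from 1: the index [i] is meant to satisfy
   [1 <= i <= d], and [e(i)] has its 1 in the column of ordinal [i - 1]. *)
Definition basis (R : nzSemiRingType) (d i : nat) : 'rV[R]_d :=
  \row_(j < d) (j.+1 == i)%:R.

Definition Xset (d : nat) : set 'rV[int]_d :=
  [set x | exists i j k : nat,
     [/\ (1 <= i <= d)%N, (1 <= j <= d)%N, (1 <= k <= d)%N,
         (d%:Z %| k%:Z - i%:Z - j%:Z)%Z &
         x = basis int d k - basis int d i - basis int d j]].
Arguments Xset : clear implicits.

(* The difference is taken in Z^d; hence a step by [- e(d)], obtained for
   [k = i] and [j = d], does not require the [i]-th coordinate of [w] to be
   positive. *)
Definition covered (d : nat) (v w : Lambda d) : Prop :=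
  Xset d (map_mx Posz v - map_mx Posz w).

Definition prec (d : nat) : Lambda d -> Lambda d -> Prop :=
  clos_trans (Lambda d) (@covered d).

Definition ne1 (d n : nat) : Lambda d := basis nat d 1 *+ n.

Definition down_set (d n : nat) : set (Lambda d) :=
  [set ne1 d n] `|` [set w | prec w (ne1 d n)].
Arguments down_set : clear implicits.

(* Main.v *)
(** Put [e(i)] in weight [i].  Every step of the order changes the weight by a
nonpositive multiple of [d]; conversely [e(i)] is reachable from [i e(1)] and
[0] from [e(d)], so any vector of weight [n - k d] is reachable from [n e(1)].
Hence the down set is the disjoint union over [k] of the sets of vectors of
weight [n - k d], and conjugation of Young diagrams identifies the vectors of
weight [m] with the partitions of [m] into at most [d] parts. *)
Require Import Defs.
From mathcomp Require Import all_boot all_order all_algebra.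
From mathcomp Require Import boolp classical_sets functions cardinality fsbigop.
From mathcomp Require Import zify.
From Stdlib Require Import Relation_Operators.

Set Implicit Arguments.
Unset Strict Implicit.
Unset Printing Implicit Defensive.

Local Open Scope ring_scope.
Local Open Scope classical_set_scope.
Local Open Scope card_scope.

Import GRing.Theory.

Definition weight {d : nat} (w : Lambda d) : nat :=
  (\sum_(j < d) j.+1 * w 0%R j)%N.

(** * Reachability of vectors from [ne1 d n] *)

Definition reach {d : nat} (v w : Lambda d) : Prop := v = w \/ prec v w.

Lemma reach_trans d (u v w : Lambda d) : reach u v -> reach v w -> reach u w.
Proof.
move=> [->//|uv] [<-|vw]; first by right.
by right; exact: t_trans uv vw.
Qed.

Lemma covered_add2r d (u v w : Lambda d) :
  covered v w -> covered (v + u) (w + u).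
Proof.
rewrite /covered; congr (Xset d _); apply/matrixP => i j.
by rewrite !mxE !PoszD opprD addrACA subrr addr0.
Qed.

Lemma reach_add2r d (u v w : Lambda d) : reach v w -> reach (v + u) (w + u).
Proof.
move=> [->|]; first by left.
move=> vw; right; elim: vw => [x y xy|x y z _ xy _ yz].
  by apply: t_step; exact: covered_add2r.
exact: t_trans xy yz.
Qed.

(** Steps depend only on differences, so chains can be translated; the basis vectors in a sum can
    thus be reached one at a time. *)
Lemma reach_add d (v w v' w' : Lambda d) :
  reach v w -> reach v' w' -> reach (v + v') (w + w').
Proof.
move=> vw vw'; apply: reach_trans (reach_add2r v' vw) _.
by rewrite ![w + _]addrC; exact: reach_add2r.
Qed.

Lemma reach_mulrn d (v w : Lambda d) k : reach v w -> reach (v *+ k) (w *+ k).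
Proof.
move=> vw; elim: k => [|k IHk]; first by rewrite !mulr0n; left.
by rewrite !mulrSr; exact: reach_add.
Qed.

Lemma reach_basis d i : (1 <= i <= d)%N -> reach (basis nat d i) (ne1 d i).
Proof.
elim: i => // -[|i] IHi /andP[_ le_id]; first by left; rewrite /ne1 mulr1n.
apply: (@reach_trans _ _ (basis nat d i.+1 + basis nat d 1)); last first.
  by rewrite /ne1 mulrSr; apply: reach_add2r; apply: IHi; exact: ltnW.
(* One step merges [e(i+1)] and [e(1)] into [e(i+2)]; here the integer to be divided by [d] is 0. *)
right; apply: t_step; exists i.+1, 1%N, i.+2; split => //; try lia.
  by have -> : i.+2%:Z - i.+1%:Z - 1%N%:Z = 0 by lia.
by apply/matrixP => a j; rewrite !mxE; lia.
Qed.

Lemma reach0 d : (0 < d)%N -> reach 0 (ne1 d d).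
Proof.
move=> d_gt0; apply: reach_trans (reach_basis (i := d) _); last first.
  by rewrite d_gt0 leqnn.
(* Taking all three indices equal to [d] gives the step [-e(d)], and the integer to be divided is
   [-d]. *)
right; apply: t_step; exists d, d, d; split; rewrite ?d_gt0 ?leqnn //.
  by rewrite subrr sub0r; apply/dvdzP; exists (-1); rewrite mulN1r.
by apply/matrixP => a j; rewrite !mxE; lia.
Qed.

Lemma basis_sum d (w : Lambda d) : w = \sum_(j < d) basis nat d j.+1 *+ w 0 j.
Proof.
apply/rowP => j; rewrite summxE (bigD1 j) //= big1 => [|i ne_ij].
  by rewrite mulmxnE mxE eqxx addr0 -mulr_natr mul1r natn.
by rewrite mulmxnE mxE eqSS eq_sym (inj_eq val_inj) (negPf ne_ij) mul0rn.
Qed.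

Lemma reach_weight d (w : Lambda d) : reach w (ne1 d (weight w)).
Proof.
rewrite {1}[w]basis_sum /weight /ne1 -sumrMnr.
apply: (big_ind2 (@reach d)); first by left.
  by move=> *; exact: reach_add.
move=> j _; rewrite mulrnA; apply: reach_mulrn; apply: reach_basis.
by rewrite ltn_ord.
Qed.

Lemma reach_ne1 d n k (w : Lambda d) :
  (0 < d)%N -> (weight w + k * d)%N = n -> reach w (ne1 d n).
Proof.
move=> d_gt0 <-; rewrite /ne1 mulrnDr -[w]addr0.
apply: reach_add; first by rewrite addr0; exact: reach_weight.
rewrite mulnC mulrnA -[0](mul0rn _ k); apply: reach_mulrn.
exact: reach0.
Qed.

(** * Change of weight along the order *)

(** Steps have negative entries, so the weight is extended to Z^d, where it is additive. *)
Definition weightz {d : nat} (x : 'rV[int]_d) : int :=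
  \sum_(j < d) j.+1%:Z * x 0 j.

Lemma weightzB d (x y : 'rV[int]_d) : weightz (x - y) = weightz x - weightz y.
Proof.
by rewrite /weightz -sumrB; apply: eq_bigr => j _; rewrite !mxE mulrBr.
Qed.

Lemma weightz_Posz d (w : Lambda d) : weightz (map_mx Posz w) = weight w.
Proof.
rewrite /weight (big_morph Posz PoszD erefl).
by apply: eq_bigr => j _; rewrite mxE PoszM.
Qed.

Lemma weightz_basis d i : (1 <= i <= d)%N -> weightz (basis int d i) = i%:Z.
Proof.
case: i => // i lt_id; rewrite /weightz (bigD1 (Ordinal lt_id)) //= big1.
  by rewrite mxE eqxx mulr1 addr0.
move=> j ne_ji; rewrite mxE eqSS; case: eqP => [e|]; last by rewrite mulr0.
by case/eqP: ne_ji; exact: val_inj.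
Qed.

Lemma weight_basis1 d : (0 < d)%N -> weight (basis nat d 1) = 1%N.
Proof.
case: d => // d _; rewrite /weight big_ord_recl big1 ?mxE //.
by move=> j _; rewrite mxE muln0.
Qed.

Lemma weight_ne1 d n : (0 < d)%N -> weight (ne1 d n) = n.
Proof.
move=> d_gt0; rewrite /weight /ne1; transitivity (weight (basis nat d 1) * n)%N.
  rewrite /weight big_distrl; apply: eq_bigr => j _ /=.
  by rewrite mulmxnE -mulr_natr natn -mulnA.
by rewrite weight_basis1 ?mul1n.
Qed.

(* [k <= d < d + i + j] rules out a positive multiple of [d]. *)
Lemma covered_weight d (v w : Lambda d) :
  covered v w -> exists k, (weight v + k * d)%N = weight w.
Proof.
move=> [i [j [k [hi hj hk /dvdzP[q eq_q] /(congr1 weightz)]]]].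
rewrite !weightzB !weightz_Posz !weightz_basis // => eq_w.
have q_le0 : q <= 0 by nia.
by exists `|q|%N; nia.
Qed.

Lemma reach_weightE d (v w : Lambda d) :
  reach v w -> exists k, (weight v + k * d)%N = weight w.
Proof.
move=> [->|]; first by exists 0%N; rewrite addn0.
elim=> [x y|x y z _ [k <-] _ [l <-]]; first exact: covered_weight.
by exists (k + l)%N; rewrite mulnDl addnA.
Qed.

Lemma down_setE d n : (0 < d)%N ->
  down_set d n = [set w | exists k, (weight w + k * d)%N = n].
Proof.
move=> d_gt0; apply/seteqP; split => w.
  by move=> /reach_weightE; rewrite weight_ne1.
by move=> [k /(reach_ne1 d_gt0)].
Qed.

(** * Partitions as vectors, through conjugation *)

(** For a partition [s], column [j] holds the multiplicity of the part [j.+1] in the conjugate of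
    [s]. The default 0 of [nth] handles the end of [s]. *)
Definition diffs (d : nat) (s : seq nat) : Lambda d :=
  \row_(j < d) (nth 0 s j - nth 0 s j.+1)%N.

Lemma nth_sorted_geq (s : seq nat) j :
  sorted geq s -> (nth 0 s j.+1 <= nth 0 s j)%N.
Proof.
move=> s_sorted; have [lt_js|le_sj] := ltnP j.+1 (size s).
  exact: (sortedP 0%N s_sorted).
by rewrite nth_default.
Qed.

(** Summation by parts. The boundary term [d * f d] vanishes when [f] lists a sequence of length at
    most [d], padded with zeros. *)
Lemma weighted_diffs (f : nat -> nat) d : (forall j, f j.+1 <= f j)%N ->
  (\sum_(j < d) j.+1 * (f j - f j.+1) + d * f d = \sum_(j < d) f j)%N.
Proof.
move=> f_dec; elim: d => [|d IHd]; first by rewrite !big_ord0.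
by rewrite !big_ord_recr /= -IHd -addnA -mulnDr subnK // mulSnr addnA.
Qed.

Lemma sumn_nth_ord d (s : seq nat) :
  (size s <= d)%N -> sumn s = (\sum_(j < d) nth 0 s j)%N.
Proof.
move=> le_sd; rewrite sumnE (big_nth 0%N) big_mkord.
rewrite (big_ord_widen _ (fun j => nth 0 s j)%N le_sd) big_mkcond.
by apply: eq_bigr => j _; case: ltnP => // /(nth_default _) ->.
Qed.

Lemma weight_diffs d (s : seq nat) :
  (size s <= d)%N -> sorted geq s -> weight (diffs d s) = sumn s.
Proof.
move=> le_sd s_sorted.
rewrite (sumn_nth_ord le_sd) -weighted_diffs; last first.
  by move=> j; exact: nth_sorted_geq.
rewrite nth_default // muln0 addn0.
by apply: eq_bigr => j _; rewrite mxE.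
Qed.

Lemma diffs_nth_inj d (s t : seq nat) :
  (size s <= d)%N -> (size t <= d)%N -> sorted geq s -> sorted geq t ->
  diffs d s = diffs d t -> forall j, nth 0%N s j = nth 0%N t j.
Proof.
move=> le_sd le_td s_sorted t_sorted /rowP eq_st j.
(* Descending induction on [j]: entries from [d] on are 0, and entry [j] is entry [j.+1] plus the
   [j]-th difference, which is not truncated because the sequences are sorted. *)
have [n] := ubnP (d - j)%N; elim: n j => // n IHn j le_n.
have [le_dj|lt_jd] := leqP d j; first by rewrite !nth_default //; lia.
have := eq_st (Ordinal lt_jd); rewrite !mxE /= (IHn j.+1); last by lia.
have := nth_sorted_geq j s_sorted; have := nth_sorted_geq j t_sorted.
by rewrite (IHn j.+1); lia.
Qed.

(** Positive entries differ from the default 0, so the values of [nth] determine the length. *)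
Lemma eq_nth_pos (s t : seq nat) : all (leq 1) s -> all (leq 1) t ->
  (forall j, nth 0%N s j = nth 0%N t j) -> s = t.
Proof.
move=> s_pos t_pos eq_st.
have le_size u v : all (leq 1) u -> (forall j, nth 0 u j = nth 0 v j)%N ->
    (size u <= size v)%N.
  move=> u_pos eq_uv; rewrite leqNgt; apply/negP => lt_vu.
  have /(all_nthP 0%N) /(_ _ lt_vu) := u_pos.
  by rewrite eq_uv nth_default.
apply: (eq_from_nth (x0 := 0%N)) => //.
by apply/eqP; rewrite eqn_leq !le_size.
Qed.

(** The zeros of a nonincreasing sequence form a suffix, and deleting them is invisible to [nth]
    with default 0. *)
Lemma nth_filter_pos (s : seq nat) j : sorted geq s ->
  nth 0%N [seq x <- s | (1 <= x)%N] j = nth 0%N s j.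
Proof.
elim: s j => //= x s IHs j xs_sorted; have s_sorted := path_sorted xs_sorted.
case: x xs_sorted => [|x] xs_sorted /=; last by case: j => //= j; exact: IHs.
rewrite IHs //; have s0 : all (pred1 0%N) s.
  have geq_trans : transitive geq by move=> a b c /= ba cb; exact: leq_trans cb ba.
  apply: sub_all (order_path_min geq_trans xs_sorted) => y /=.
  by rewrite leqn0.
by move/all_pred1P: s0 => ->; case: j => [|j] /=; rewrite !nth_nseq !if_same.
Qed.

(** The tail sums of [w] are nonincreasing with successive differences [w]; dropping their zeros
    leaves a partition. *)
Lemma diffs_surj d (w : Lambda d) : exists s : seq nat,
  [/\ (size s <= d)%N, sorted geq s, all (leq 1) s & diffs d s = w].
Proof.
pose f j := (\sum_(i < d | j <= i) w 0%R i)%N.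
have f_dec j : (f j.+1 <= f j)%N.
  rewrite /f [X in (_ <= X)%N](bigID (fun i : 'I_d => (j < i)%N)) /=.
  apply: leq_trans (leq_addr _ _); apply: eq_leq; apply: eq_bigl => i.
  by lia.
have t_sorted : sorted geq (mkseq f d).
  apply/(sortedP 0%N) => i; rewrite size_mkseq => lt_id.
  by rewrite !nth_mkseq ?(ltnW lt_id) //; exact: f_dec.
exists [seq x <- mkseq f d | (1 <= x)%N]; split.
- by rewrite size_filter (leq_trans (count_size _ _)) // size_mkseq.
- apply: sorted_filter t_sorted => a b c /= ba cb; exact: leq_trans cb ba.
- exact: filter_all.
apply/rowP => j; rewrite mxE !nth_filter_pos // nth_mkseq //.
(* In the last column, [j.+1] equals [d]: the default 0 agrees with the empty sum [f d]. *)
have -> : nth 0%N (mkseq f d) j.+1 = f j.+1.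
  have [lt_jd|le_dj] := ltnP j.+1 d; first by rewrite nth_mkseq.
  rewrite nth_default ?size_mkseq // /f big1 // => i le_ji.
  by have := ltn_ord i; lia.
rewrite {1}/f (bigD1 j) //= /f (eq_bigl (fun i : 'I_d => j < i)%N) ?addnK //.
by move=> i; rewrite -val_eqE /=; lia.
Qed.

(** * Enumeration by weight and the final count *)

Definition parts (d m : nat) : seq (seq nat) :=
  [seq map val (val s) |
     s <- enum [set s : d.-bseq 'I_m.+1 | is_partition m (map val s)]%SET].

Lemma size_parts d m : size (parts d m) = npart_nat d m.
Proof. by rewrite size_map -cardE. Qed.

Lemma parts_uniq d m : uniq (parts d m).
Proof.
rewrite map_inj_uniq ?enum_uniq // => s t /(inj_map val_inj).
exact: val_inj.
Qed.

Lemma mem_parts d m s : (s \in parts d m) = (size s <= d)%N && is_partition m s.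
Proof.
apply/mapP/andP => [[t]|[le_sd s_part]].
  by rewrite mem_enum inE => t_part ->; rewrite size_map size_bseq.
have s_lt x : x \in s -> (x < m.+1)%N.
  case/and3P: s_part => _ _ /eqP <- xs; rewrite ltnS sumnE.
  by rewrite (big_rem x) //= leq_addr.
pose t := [seq (inord x : 'I_m.+1) | x <- s].
have val_t : map val t = s.
  rewrite -map_comp -[RHS]map_id; apply/eq_in_map => x xs /=.
  by rewrite inordK // s_lt.
have le_td : (size t <= d)%N by rewrite size_map.
by exists (Bseq le_td); rewrite ?mem_enum ?inE /= val_t.
Qed.

Definition vectors (d m : nat) : seq (Lambda d) := map (diffs d) (parts d m).

Lemma size_vectors d m : size (vectors d m) = npart_nat d m.
Proof. by rewrite size_map size_parts. Qed.

Lemma vectors_uniq d m : uniq (vectors d m).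
Proof.
rewrite map_inj_in_uniq ?parts_uniq // => s t; rewrite !mem_parts.
move=> /and4P[le_sd s_sorted s_pos _] /and4P[le_td t_sorted t_pos _] eq_st.
by apply: eq_nth_pos => //; apply: diffs_nth_inj eq_st.
Qed.

Lemma mem_vectors d m w : (w \in vectors d m) = (weight w == m).
Proof.
apply/mapP/eqP => [[s]|w_m].
  rewrite mem_parts => /and4P[le_sd s_sorted _ /eqP <-] ->.
  exact: weight_diffs.
have [s [le_sd s_sorted s_pos sw]] := diffs_surj w.
exists s => //; rewrite mem_parts le_sd /is_partition s_sorted s_pos /=.
by rewrite -(weight_diffs le_sd) // sw w_m.
Qed.

Lemma card_eq_size (T : choiceType) (s : seq T) :
  uniq s -> [set` s] #= `I_(size s).
Proof.
move=> s_uniq; apply/pcard_eqP.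
suff /Pbij[f] : set_bij [set` s] `I_(size s) (index^~ s) by squash f.
split => [x /=|x y|i /=]; first by rewrite index_mem.
  by rewrite !inE; exact: index_inj.
case: s s_uniq => // x s s_uniq lt_is.
by exists (nth x (x :: s) i); [exact: mem_nth | exact: index_uniq].
Qed.

Lemma npart_sub d n k : npart d (n%:Z - k%:Z * d%:Z) =
  if (k * d <= n)%N then npart_nat d (n - k * d) else 0%N.
Proof.
rewrite -PoszM; case: leqP => [le_kn|lt_nk]; first by rewrite subzn.
by case E: (n%:Z - _) => [m|//]; lia.
Qed.

(* The sum over k has finite support when 0 < d, so the finitely supported
   sum over all naturals is the sum displayed. *)
Theorem theorem7p1 (d : nat) (d_gt0 : (0 < d)%N) (n : nat) :
  down_set d n #=
    `I_(\big[addn/0%N]_(k \in [set: nat]) npart d (n%:Z - k%:Z * d%:Z)).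
Proof.
(* These are the [k] with [n - k d] nonnegative; [k <= n] loses none of them since [d] is
   positive. *)
pose r := [seq k <- iota 0 n.+1 | (k * d <= n)%N].
have mem_r k : (k \in r) = (k * d <= n)%N.
  by rewrite mem_filter mem_iota; nia.
have r_uniq : uniq r by rewrite filter_uniq ?iota_uniq.
rewrite (fsbigE r) //; last first.
  by move=> k _; rewrite mem_r npart_sub => /negPf ->.
pose L := [seq w | k <- r, w <- vectors d (n - k * d)].
have -> : down_set d n = [set` L].
  rewrite down_setE //; apply/seteqP; split => w /=.
    move=> [k wk]; apply/allpairsPdep; exists k, w.
    by rewrite mem_r mem_vectors; split=> //; lia.
  move=> /allpairsPdep[k [v [+ + ->]]]; rewrite mem_r mem_vectors.
  by move=> le_kn /eqP ->; exists k; rewrite subnK.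
have -> : (\sum_(k <- r | k \in [set: nat]) npart d (n%:Z - k%:Z * d%:Z))%N
    = size L.
  rewrite size_allpairs_dep sumnE big_map big_seq_cond [RHS]big_seq_cond.
  apply: eq_big => [k|k /andP[kr _]]; first by rewrite in_setT.
  by rewrite npart_sub -mem_r kr size_vectors.
apply: card_eq_size; apply: allpairs_uniq_dep => //.
  by move=> k _; exact: vectors_uniq.
(* No vector is listed twice: its weight is [n - k * d], which determines [k] because the
   subtraction is not truncated for [k] in [r]. *)
move=> _ _ /allpairsPdep[k [v [kr vk ->]]] /allpairsPdep[l [w [lr wl ->]]] /=.
move: kr lr vk wl; rewrite !mem_r !mem_vectors => le_kn le_ln + + eq_vw.
rewrite eq_vw => /eqP -> /eqP eq_kl.
by have -> : k = l by nia.
Qed.
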